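(* We have the $\mathrm{des}$-Wilf equivalence $\underline{312}4\overset{\mathrm{des}}{\sim}\underline{231}4$.
   Context: $\mathfrak{S}_n$ is the set of permutations of $\{1,\ldots,n\}$ in one-line notation, and $\mathrm{des}(\pi)=|\{i\in[n-1]:\pi_i>\pi_{i+1}\}|$. An occurrence of the pattern $\underline{abc}d$ (where $abcd\in\mathfrak{S}_4$) in $\pi$ is a subsequence $\pi_i\pi_{i+1}\pi_{i+2}\pi_j$ with $j>i+2$ order-isomorphic to $abcd$. $\mathfrak{S}_n(\omega)$ is the set of permutations in $\mathfrak{S}_n$ with no occurrence of $\omega$. $\omega\overset{\mathrm{des}}{\sim}\omega'$ means $|\{\pi\in\mathfrak{S}_n(\omega):\mathrm{des}(\pi)=m\}|=|\{\pi\in\mathfrak{S}_n(\omega'):\mathrm{des}(\pi)=m\}|$ for all $n\ge1$ and $m\ge0$. *)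

(* Defs.v *)
From mathcomp Require Import all_boot all_fingroup.

Set Implicit Arguments.
Unset Strict Implicit.
Unset Printing Implicit Defensive.

(* A permutation of {1, ..., n} is a term of 'S_n: positions and values are
   both shifted down by 1, which affects neither descents nor patterns. *)

Definition des n (s : 'S_n) : nat :=
  #|[set i : 'I_n | [exists j : 'I_n, (j == i.+1 :> nat) && (s j < s i)]]|.

Definition order_isomorphic k (u v : k.-tuple nat) : bool :=
  [forall a : 'I_k, forall b : 'I_k,
    (tnth u a < tnth u b) == (tnth v a < tnth v b)].

(* The vincular pattern whose first three letters are underlined is given by
   its one-line word w = [tuple a; b; c; d], so w is meant to be a permutation
   of 1, 2, 3, 4. *)
Definition occurrence n (w : 4.-tuple nat) (s : 'S_n) (i i1 i2 j : 'I_n) :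
    bool :=
  [&& i1 == i.+1 :> nat, i2 == i.+2 :> nat, i.+2 < j &
    order_isomorphic [tuple val (s i); val (s i1); val (s i2); val (s j)] w].

Definition avoiders n (w : 4.-tuple nat) : {set 'S_n} :=
  [set s : 'S_n | ~~ [exists i, exists i1, exists i2, exists j,
                        occurrence w s i i1 i2 j]].

Definition des_wilf_equiv (w w' : 4.-tuple nat) : Prop :=
  forall n m : nat, 0 < n ->
    #|[set s in avoiders n w | des s == m]|
    = #|[set s in avoiders n w' | des s == m]|.

(* Main.v *)
(* Write a word with distinct letters as [L m R] with [m] its maximum. A pattern
   whose first three letters are adjacent and whose last letter is the largest is
   avoided iff [L] avoids the consecutive pattern of the first three letters and
   [R] avoids the full pattern: no occurrence can use [m] among its first three
   letters, while [m] completes any triple of [L]. Reverse complement of [L]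
   within its own set of letters exchanges 231 and 312 and preserves descents;
   applying it to [L] and recursing on [R] gives an involution. *)
Require Import Defs.
From mathcomp Require Import all_boot all_fingroup.
From mathcomp Require Import zify.

Set Implicit Arguments.
Unset Strict Implicit.
Unset Printing Implicit Defensive.

(** * Reverse complement of a word within its own letters *)

(** For distinct letters, the order-reversing bijection of the letters of [L]. *)
Definition complement_in (L : seq nat) (x : nat) : nat :=
  nth 0 (sort leq L) (size L - (index x (sort leq L)).+1).

Definition reverse_complement (L : seq nat) : seq nat :=
  map (complement_in L) (rev L).

Lemma complement_in_mem (L : seq nat) x : x \in L -> complement_in L x \in L.
Proof.
move=> xL; rewrite -(mem_sort leq) mem_nth // size_sort.
by case: L xL => //= y L _; rewrite subSS ltnS leq_subr.
Qed.

Lemma ltn_sorted_sort (L : seq nat) : uniq L -> sorted ltn (sort leq L).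
Proof.
by move=> uL; rewrite ltn_sorted_uniq_leq sort_uniq uL sort_sorted //; apply: leq_total.
Qed.

Lemma complement_inK (L : seq nat) (x : nat) :
  uniq L -> x \in L -> complement_in L (complement_in L x) = x.
Proof.
move=> uL xL; rewrite /complement_in.
have ix : index x (sort leq L) < size L.
  by rewrite -[X in _ < X](size_sort leq) index_mem mem_sort.
have lt : size L - (index x (sort leq L)).+1 < size L by lia.
rewrite index_uniq ?sort_uniq ?size_sort //.
have -> : size L - (size L - (index x (sort leq L)).+1).+1 = index x (sort leq L) by lia.
by rewrite nth_index // mem_sort.
Qed.

Lemma complement_in_ltn (L : seq nat) (x y : nat) : uniq L -> x \in L -> y \in L ->
  (complement_in L x < complement_in L y) = (y < x).
Proof.
move=> uL; move: x y.
(* One implication suffices: by trichotomy, the converse is the same implication with [x] and [y]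
   exchanged. *)
have mono (x y : nat) : x \in L -> y \in L -> y < x -> complement_in L x < complement_in L y.
  move=> xL yL lt_yx.
  have ix : index x (sort leq L) < size L.
    by rewrite -[X in _ < X](size_sort leq) index_mem mem_sort.
  have iy : index y (sort leq L) < size L.
    by rewrite -[X in _ < X](size_sort leq) index_mem mem_sort.
  have lt_ixy : index y (sort leq L) < index x (sort leq L).
    rewrite ltnNge; apply: contraL lt_yx; rewrite -leqNgt => le_ixy.
    rewrite -[x](nth_index 0 (s := sort leq L)) ?mem_sort //.
    rewrite -[X in _ <= X](nth_index 0 (s := sort leq L)) ?mem_sort //.
    apply: (sorted_leq_nth leq_trans leqnn) => //; rewrite ?inE ?size_sort //.
    by apply: sort_sorted; apply: leq_total.
  apply: (sorted_ltn_nth ltn_trans 0 (ltn_sorted_sort uL)); rewrite ?inE ?size_sort; lia.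
move=> x y xL yL; apply/idP/idP => [|lt_yx]; last exact: mono.
case: (ltngtP x y) => // [lt_xy|->]; last by rewrite ltnn.
by rewrite ltnNge ltnW // mono.
Qed.

Lemma perm_reverse_complement (L : seq nat) : uniq L -> perm_eq (reverse_complement L) L.
Proof.
move=> uL; have uc : uniq (reverse_complement L).
  rewrite map_inj_in_uniq ?rev_uniq // => x y; rewrite !mem_rev => xL yL e.
  by rewrite -(complement_inK uL xL) e complement_inK.
apply: uniq_perm => //.
(* Distinct letters, all taken from [L] and as many as in [L], are all of [L]. *)
apply: (uniq_min_size uc _ _).2; last by rewrite size_map size_rev.
by move=> y /mapP[x]; rewrite mem_rev => xL ->; apply: complement_in_mem.
Qed.

Lemma size_reverse_complement (L : seq nat) : size (reverse_complement L) = size L.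
Proof. by rewrite size_map size_rev. Qed.

Lemma reverse_complementK (L : seq nat) :
  uniq L -> reverse_complement (reverse_complement L) = L.
Proof.
move=> uL.
(* Both words have the same letters, hence the same sorted list, so the second application
   complements by the same map. *)
have eqc : complement_in (reverse_complement L) =1 complement_in L.
  move=> x; rewrite /complement_in size_reverse_complement.
  suff -> : sort leq (reverse_complement L) = sort leq L by [].
  by apply/perm_sortP; rewrite ?perm_reverse_complement //;
    [apply: leq_total | apply: leq_trans | apply: anti_leq].
rewrite {1}/reverse_complement (eq_map eqc) -map_rev revK -map_comp.
rewrite -[RHS]map_id; apply/eq_in_map => x xL /=; exact: complement_inK.
Qed.

Lemma nth_reverse_complement (L : seq nat) i : i < size L ->
  nth 0 (reverse_complement L) i = complement_in L (nth 0 L (size L - i.+1)).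
Proof. by move=> iL; rewrite (nth_map 0) ?size_rev // nth_rev. Qed.

(** * The involution on words *)

(* Replaces by its reverse complement each maximal block of entries lying
   between two consecutive right-to-left maxima; [k] bounds the recursion. *)
Fixpoint flip_blocks_rec (k : nat) (s : seq nat) : seq nat :=
  if k is k'.+1 then
    if s is [::] then [::] else
    let m := \max_(x <- s) x in
    let i := index m s in
    reverse_complement (take i s) ++ m :: flip_blocks_rec k' (drop i.+1 s)
  else [::].

Definition flip_blocks (s : seq nat) : seq nat := flip_blocks_rec (size s) s.

Definition max_split (L : seq nat) (m : nat) (R : seq nat) : bool :=
  all (fun x => x < m) L && all (fun x => x < m) R.

Lemma max_splitP (s : seq nat) : uniq s -> s != [::] ->
  exists (L : seq nat) (m : nat) (R : seq nat), s = L ++ m :: R /\ max_split L m R.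
Proof.
move=> us nz; set m := \max_(x <- s) x.
have ms : m \in s.
  rewrite /m; case: s us nz {m} => // a s _ _; elim: s a => [|b s IH] a.
    by rewrite big_seq1 mem_head.
  rewrite big_cons; case: (leqP a (\max_(j <- b :: s) j)) => _.
    by rewrite in_cons IH orbT.
  exact: mem_head.
have le_m x : x \in s -> x <= m by move=> xs; apply: leq_bigmax_seq.
clearbody m; case/splitPr: ms us le_m {nz} => L R; rewrite -cat_rcons cat_uniq => us le_m.
exists L, m, R; split; first by rewrite cat_rcons.
move: us; rewrite rcons_uniq -andbA => /and4P[mL _ /hasPn mR _].
apply/andP; split; apply/allP => x xs; rewrite ltn_neqAle le_m ?andbT;
  rewrite ?mem_cat ?mem_rcons ?in_cons ?xs ?orbT //.
  by apply: contraNneq mL => <-.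
by apply/eqP => xm; have := mR x xs; rewrite xm mem_rcons mem_head.
Qed.

(** Induction along the right-to-left maxima. Only [R] gets an induction hypothesis, because
    [flip_blocks] treats [L] in one step. *)
Lemma max_split_ind (P : seq nat -> Prop) : P [::] ->
  (forall L m R, max_split L m R -> uniq L -> uniq R -> P R -> P (L ++ m :: R)) ->
  forall s : seq nat, uniq s -> P s.
Proof.
move=> P0 PS s; have [k] := ubnP (size s); elim: k s => // k IH s.
have [-> //|nz] := eqVneq s [::] => lt_sk us.
have [L [m [R [es ms]]]] := max_splitP us nz.
move: us lt_sk; rewrite es cat_uniq size_cat => /and3P[uL _ /andP[_ uR]] /= lt_sk.
by apply: PS => //; apply: IH => //; lia.
Qed.

Lemma flip_blocks_rec_max_split k L m R : max_split L m R ->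
  flip_blocks_rec k.+1 (L ++ m :: R)
  = reverse_complement L ++ m :: flip_blocks_rec k R.
Proof.
move=> /andP[/allP mL /allP mR].
have e : \max_(x <- L ++ m :: R) x = m.
  apply/eqP; rewrite eqn_leq leq_bigmax_seq ?mem_cat ?mem_head ?orbT // andbT.
  apply/bigmax_leqP_seq => x; rewrite mem_cat in_cons.
  by case/or3P => [/mL/ltnW|/eqP->|/mR/ltnW].
have mNL : m \notin L by apply/negP => /mL; rewrite ltnn.
rewrite /=; case E : {1}(L ++ m :: R) => [|a s]; first by case: (L) E.
rewrite e index_cat (negbTE mNL) /= eqxx addn0 take_size_cat //.
by rewrite -[X in drop _ X]cat_rcons drop_size_cat ?size_rcons.
Qed.

(** After one unfolding of [flip_blocks] on [L ++ m :: R], the remaining bound is [size L + size R]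
    and not [size R]; this lemma absorbs the excess. *)
Lemma flip_blocks_rec_size k s : uniq s -> size s <= k ->
  flip_blocks_rec k s = flip_blocks s.
Proof.
move=> us; rewrite /flip_blocks; elim/max_split_ind: us k => {s} [|L m R LmR uL uR IH] k.
  by case: k.
rewrite size_cat /= addnS; case: k => // k lek.
have leRk : size R <= k by lia.
by rewrite !flip_blocks_rec_max_split // (IH k) // (IH (_ + _)) ?leq_addl.
Qed.

Lemma flip_blocks_max_split L m R : max_split L m R -> uniq R ->
  flip_blocks (L ++ m :: R) = reverse_complement L ++ m :: flip_blocks R.
Proof.
move=> LmR uR; rewrite {1}/flip_blocks size_cat /= addnS flip_blocks_rec_max_split //.
by rewrite flip_blocks_rec_size // leq_addl.
Qed.

Lemma perm_flip_blocks (s : seq nat) : uniq s -> perm_eq (flip_blocks s) s.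
Proof.
elim/max_split_ind => // L m R LmR uL uR IH; rewrite flip_blocks_max_split //.
by rewrite perm_cat ?perm_reverse_complement // perm_cons.
Qed.

(** Both maps only permute letters, so the image splits at the same maximum and the splitting lemmas
    apply to it again. *)
Lemma max_split_flip L m R : uniq L -> uniq R -> max_split L m R ->
  max_split (reverse_complement L) m (flip_blocks R).
Proof.
move=> uL uR; rewrite /max_split.
by rewrite (perm_all _ (perm_reverse_complement uL)) (perm_all _ (perm_flip_blocks uR)).
Qed.

Lemma flip_blocksK (s : seq nat) : uniq s -> flip_blocks (flip_blocks s) = s.
Proof.
elim/max_split_ind => // L m R LmR uL uR IH; rewrite flip_blocks_max_split //.
rewrite flip_blocks_max_split ?max_split_flip ?(perm_uniq (perm_flip_blocks uR)) //.
by rewrite IH reverse_complementK.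
Qed.

(** * Descents of words *)

Definition seq_des (s : seq nat) : nat :=
  \sum_(0 <= i < (size s).-1) (nth 0 s i.+1 < nth 0 s i).

Lemma seq_des_cons a s :
  seq_des (a :: s) = ((s != [::]) && (head 0 s < a)) + seq_des s.
Proof.
rewrite /seq_des; case: s => [|b s] /=; first by rewrite !big_geq.
by rewrite big_nat_recl.
Qed.

(** The step into [m] is an ascent; the step out of [m], if there is one, is a descent. *)
Lemma seq_des_max_split L m R : max_split L m R ->
  seq_des (L ++ m :: R) = seq_des L + (R != [::]) + seq_des R.
Proof.
case/andP; elim: L => [|a L IH] /= => [_ mR|/andP[am mL] mR].
  rewrite seq_des_cons [seq_des [::]]/seq_des big_geq //.
  by case: R mR => //= b R /andP[-> _].
rewrite !seq_des_cons IH // !addnA; congr (_ + _ + _ + _).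
case: L {IH} mL => [|b L] //= _; by rewrite ltnNge ltnW.
Qed.

(** Reversal exchanges ascents and descents, and complementation exchanges them back; hence the sum
    is read from its other end. *)
Lemma seq_des_reverse_complement (L : seq nat) :
  uniq L -> seq_des (reverse_complement L) = seq_des L.
Proof.
move=> uL; have memL k : k < size L -> nth 0 L k \in L by exact: mem_nth.
rewrite /seq_des size_reverse_complement big_nat_rev /=.
apply: eq_big_nat => i /andP[_ ltiL]; congr nat_of_bool.
rewrite !nth_reverse_complement ?complement_in_ltn ?memL //; try lia.
by congr (nth 0 L _ < nth 0 L _); lia.
Qed.

Lemma seq_des_flip_blocks (s : seq nat) : uniq s -> seq_des (flip_blocks s) = seq_des s.
Proof.
elim/max_split_ind => // L m R LmR uL uR IH; rewrite flip_blocks_max_split //.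
rewrite !seq_des_max_split ?max_split_flip // seq_des_reverse_complement // IH.
by rewrite -!size_eq0 (perm_size (perm_flip_blocks uR)).
Qed.

(** * Pattern avoidance in words *)

Definition avoids3 (p : nat -> nat -> nat -> bool) (s : seq nat) : Prop :=
  forall i, i.+2 < size s -> ~~ p (nth 0 s i) (nth 0 s i.+1) (nth 0 s i.+2).

(** Boolean, so that avoiding words can be counted. Truncated subtraction makes the range of [i]
    empty for [j <= 2]. *)
Definition avoids3_max (p : nat -> nat -> nat -> bool) (s : seq nat) : bool :=
  all (fun j => all (fun i =>
      ~~ [&& p (nth 0 s i) (nth 0 s i.+1) (nth 0 s i.+2), nth 0 s i < nth 0 s j,
            nth 0 s i.+1 < nth 0 s j & nth 0 s i.+2 < nth 0 s j])
    (iota 0 (j - 2))) (iota 0 (size s)).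

Lemma avoids3_maxP (p : nat -> nat -> nat -> bool) (s : seq nat) : reflect
  (forall i j, i.+2 < j < size s -> p (nth 0 s i) (nth 0 s i.+1) (nth 0 s i.+2) ->
    ~~ [&& nth 0 s i < nth 0 s j, nth 0 s i.+1 < nth 0 s j & nth 0 s i.+2 < nth 0 s j])
  (avoids3_max p s).
Proof.
apply: (iffP allP) => [H i j /andP[ij js] pi|H j]; last first.
  rewrite mem_iota => js; apply/allP => i; rewrite mem_iota => ij.
  by rewrite negb_and -implybE; apply/implyP; apply: H; lia.
have /H/allP/(_ i) : j \in iota 0 (size s) by rewrite mem_iota.
by rewrite pi mem_iota; apply; lia.
Qed.

Lemma avoids3_max_split (p : nat -> nat -> nat -> bool) L m R : max_split L m R ->
  avoids3_max p (L ++ m :: R) <-> avoids3 p L /\ avoids3_max p R.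
Proof.
case/andP => /allP mL /allP mR.
have nL i : i < size L -> nth 0 (L ++ m :: R) i = nth 0 L i by rewrite nth_cat => ->.
have nM : nth 0 (L ++ m :: R) (size L) = m by rewrite nth_cat ltnn subnn.
have nR i : nth 0 (L ++ m :: R) (size L + i.+1) = nth 0 R i.
  by rewrite nth_cat ltnNge leq_addr addKn.
have sz : size (L ++ m :: R) = size L + (size R).+1 by rewrite size_cat.
split=> [/avoids3_maxP H|[HL /avoids3_maxP HR]].
  split=> [i iL|]; last first.
    apply/avoids3_maxP => i j ij.
    by have := H (size L + i.+1) (size L + j.+1); rewrite -!addnS !nR sz; apply; lia.
  (* The maximum [m], at position [size L], would complete the triple to an occurrence. *)
  apply/negP => pi; have := H i (size L); rewrite nM !nL; try lia.
  have ltm k : k < size L -> nth 0 L k < m by move=> kL; apply/mL/mem_nth.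
  by rewrite !ltm; lia.
apply/avoids3_maxP => i j; rewrite sz => ij.
(* The triple starting at [i] lies inside [L], contains [m], or lies inside [R]. In the second case
   [j] points into [R], at a letter too small to exceed [m]. *)
have [iL|Li] := ltnP i.+2 (size L).
  by have := HL i iL; rewrite -!nL; try lia; move/negbTE->.
have [iL _|{}Li] := leqP i (size L).
  have lt_jm : nth 0 (L ++ m :: R) j < m.
    have -> : j = size L + (j - (size L).+1).+1 by lia.
    have jR : j - (size L).+1 < size R by lia.
    by rewrite nR; apply/mR/mem_nth.
  have [e|[e|e]] : i = size L \/ i.+1 = size L \/ i.+2 = size L by lia.
  - by rewrite e nM (ltnNge m) (ltnW lt_jm).
  - by rewrite e nM (ltnNge m) (ltnW lt_jm) !andbF.
  - by rewrite e nM (ltnNge m) (ltnW lt_jm) !andbF.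
have -> : i = size L + (i - (size L).+1).+1 by lia.
have -> : j = size L + (j - (size L).+1).+1 by lia.
by rewrite -!addnS !nR; apply: HR; lia.
Qed.

Definition is312 (a b c : nat) : bool := b < c < a.
Definition is231 (a b c : nat) : bool := c < a < b.

(** The three letters at [i] in the image come from those at [size L - i.+3] in [L], read backwards:
    231 reverses to 132, whose complement is 312. *)
Lemma avoids3_reverse_complement (L : seq nat) : uniq L ->
  avoids3 is312 (reverse_complement L) <-> avoids3 is231 L.
Proof.
move=> uL; have memL k : k < size L -> nth 0 L k \in L by exact: mem_nth.
have key i : i.+2 < size L ->
    is312 (nth 0 (reverse_complement L) i) (nth 0 (reverse_complement L) i.+1)
          (nth 0 (reverse_complement L) i.+2)
    = is231 (nth 0 L (size L - i.+3)) (nth 0 L (size L - i.+3).+1)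
            (nth 0 L (size L - i.+3).+2).
  move=> iL; have -> : (size L - i.+3).+2 = size L - i.+1 by lia.
  have -> : (size L - i.+3).+1 = size L - i.+2 by lia.
  rewrite /is312 !nth_reverse_complement ?complement_in_ltn ?memL //; try lia.
  by rewrite /is231 andbC.
split=> H i; rewrite ?size_reverse_complement => iL; last by rewrite key //; apply: H; lia.
have := H (size L - i.+3); rewrite size_reverse_complement key; last by lia.
by have -> : size L - (size L - i.+3).+3 = i by [lia]; apply; lia.
Qed.

Lemma avoids3_max_flip_blocks (s : seq nat) : uniq s ->
  avoids3_max is312 (flip_blocks s) = avoids3_max is231 s.
Proof.
elim/max_split_ind => // L m R LmR uL uR IH; rewrite flip_blocks_max_split //.
have flipLmR := max_split_flip uL uR LmR.
have avE := avoids3_reverse_complement uL.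
apply/idP/idP => [/(avoids3_max_split _ flipLmR)|/(avoids3_max_split _ LmR)] [avL avR].
  by apply/avoids3_max_split => //; rewrite -IH; split=> //; apply/avE.
by apply/avoids3_max_split => //; rewrite IH; split=> //; apply/avE.
Qed.

(** * From permutations to words *)

Definition one_line n (s : 'S_n) : seq nat := [seq val (s i) | i <- enum 'I_n].

Lemma size_one_line n (s : 'S_n) : size (one_line s) = n.
Proof. by rewrite size_map size_enum_ord. Qed.

Lemma nth_one_line n (s : 'S_n) (i : 'I_n) : nth 0 (one_line s) i = s i.
Proof. by rewrite (nth_map i) ?size_enum_ord // nth_ord_enum. Qed.

Lemma perm_one_lines n :
  perm_eq [seq one_line s | s : 'S_n] (permutations (iota 0 n)).
Proof.
have u1 : uniq [seq one_line s | s : 'S_n].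
  rewrite map_inj_uniq ?enum_uniq // => s t e; apply/permP => i; apply: val_inj.
  by rewrite /= -!nth_one_line e.
apply: uniq_perm => //; first exact: permutations_uniq.
(* Inclusion is enough, since both lists have [n!] distinct members. *)
apply: (uniq_min_size u1 _ _).2.
  move=> _ /mapP[s _ ->]; rewrite mem_permutations.
  have us : uniq (one_line s).
    by rewrite map_inj_uniq ?enum_uniq // => i j /val_inj/perm_inj.
  apply: uniq_perm; rewrite ?iota_uniq //.
  apply: (uniq_min_size us _ _).2; last by rewrite size_iota size_one_line.
  by move=> _ /mapP[i _ ->]; rewrite mem_iota /= add0n ltn_ord.
by rewrite size_permutations ?iota_uniq // size_iota size_map -cardE card_Sn.
Qed.

Lemma des_one_line n (s : 'S_n) : des s = seq_des (one_line s).
Proof.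
rewrite /des /seq_des size_one_line -sum1_card big_mkcond /=.
case: n s => [|n] s; first by rewrite big_ord0 big_geq.
(* [des] ranges over all positions, [seq_des] stops one earlier; the last position has no successor
   and contributes 0. *)
rewrite big_ord_recr /= big_mkord [X in _ + X]ifF ?addn0; last first.
  by rewrite inE; apply/negbTE/existsPn => j; rewrite (ltn_eqF (ltn_ord j)).
apply: eq_bigr => i _; rewrite inE.
have -> : nth 0 (one_line s) i = s (widen_ord (leqnSn n) i) by rewrite -nth_one_line.
have -> : nth 0 (one_line s) i.+1 = s (lift ord0 i) by rewrite -nth_one_line.
case: existsP => [[j /andP[/eqP ej]]|H].
  by have -> : j = lift ord0 i by [apply: val_inj]; move->.
by case: ltnP => // lt; case: H; exists (lift ord0 i); rewrite lt andbT.
Qed.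

Lemma order_isomorphic_3124 a b c d :
  order_isomorphic [tuple a; b; c; d] [tuple 3; 1; 2; 4]
  = is312 a b c && [&& a < d, b < d & c < d].
Proof.
rewrite /is312; apply/'forall_'forall_eqP/idP => [H|].
  have H4 (i j : nat) (hi : i < 4) (hj : j < 4) := H (Ordinal hi) (Ordinal hj).
  (* These three comparisons give the chain [b < c < a < d], which settles all the others. *)
  have := H4 1 2 isT isT; have := H4 2 0 isT isT; have := H4 0 3 isT isT.
  by rewrite !(tnth_nth 0) /=; lia.
by move=> H [[|[|[|[|i]]]] hi] [[|[|[|[|j]]]] hj]; rewrite !(tnth_nth 0) //=; lia.
Qed.

Lemma order_isomorphic_2314 a b c d :
  order_isomorphic [tuple a; b; c; d] [tuple 2; 3; 1; 4]
  = is231 a b c && [&& a < d, b < d & c < d].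
Proof.
rewrite /is231; apply/'forall_'forall_eqP/idP => [H|].
  have H4 (i j : nat) (hi : i < 4) (hj : j < 4) := H (Ordinal hi) (Ordinal hj).
  have := H4 2 0 isT isT; have := H4 0 1 isT isT; have := H4 1 3 isT isT.
  by rewrite !(tnth_nth 0) /=; lia.
by move=> H [[|[|[|[|i]]]] hi] [[|[|[|[|j]]]] hj]; rewrite !(tnth_nth 0) //=; lia.
Qed.

(** The hypothesis says that the last letter of [w] is its largest and that [p] describes the first
    three, so one proof serves both patterns. *)
Lemma avoiders_one_line w (p : nat -> nat -> nat -> bool) n (s : 'S_n) :
  (forall a b c d, order_isomorphic [tuple a; b; c; d] w
     = p a b c && [&& a < d, b < d & c < d]) ->
  (s \in avoiders n w) = avoids3_max p (one_line s).
Proof.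
move=> wE; rewrite inE; apply/idP/idP => [H|/avoids3_maxP H].
  apply/avoids3_maxP => i j; rewrite size_one_line => /andP[ij jn] pi.
  apply: contra H => lt.
  have i0 : i < n by lia.
  have i1 : i.+1 < n by lia.
  have i2 : i.+2 < n by lia.
  apply/existsP; exists (Ordinal i0); apply/existsP; exists (Ordinal i1).
  apply/existsP; exists (Ordinal i2); apply/existsP; exists (Ordinal jn).
  by rewrite /occurrence wE /= -!nth_one_line /= !eqxx ij pi lt.
apply/existsP => -[i /existsP[i1 /existsP[i2 /existsP[j /and4P[/eqP e1 /eqP e2 ij]]]]].
rewrite wE /= => /andP[pi lt].
have := H i j; rewrite size_one_line ij ltn_ord -e2 -e1 !nth_one_line pi.
by rewrite lt => /(_ isT isT).
Qed.

(** * Counting through the involution *)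

Lemma card_avoiders_des w (p : nat -> nat -> nat -> bool) n m :
  (forall a b c d, order_isomorphic [tuple a; b; c; d] w
     = p a b c && [&& a < d, b < d & c < d]) ->
  #|[set s in avoiders n w | des s == m]|
  = count (fun t => avoids3_max p t && (seq_des t == m)) (permutations (iota 0 n)).
Proof.
move=> wE; rewrite -(seq.permP (perm_one_lines n)) count_map.
rewrite -sum1_count big_enum_cond -sum1_card; apply: eq_bigl => s /=.
by rewrite in_set (avoiders_one_line _ wE) des_one_line.
Qed.

Lemma perm_flip_permutations n :
  perm_eq (map flip_blocks (permutations (iota 0 n))) (permutations (iota 0 n)).
Proof.
have uniq_mem t : t \in permutations (iota 0 n) -> uniq t.
  by rewrite mem_permutations => /perm_uniq->; apply: iota_uniq.
have u1 : uniq (map flip_blocks (permutations (iota 0 n))).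
  rewrite map_inj_in_uniq ?permutations_uniq // => s t /uniq_mem us /uniq_mem ut e.
  by rewrite -(flip_blocksK us) e flip_blocksK.
apply: uniq_perm => //; first exact: permutations_uniq.
apply: (uniq_min_size u1 _ _).2; last by rewrite size_map.
move=> _ /mapP[t tn ->]; move: (tn); rewrite !mem_permutations.
by apply: perm_trans; apply: perm_flip_blocks; apply: uniq_mem.
Qed.

Theorem theorem3p1 : des_wilf_equiv [tuple 3; 1; 2; 4] [tuple 2; 3; 1; 4].
Proof.
move=> n m _.
apply: (etrans (card_avoiders_des n m order_isomorphic_3124)).
apply: (etrans _ (esym (card_avoiders_des n m order_isomorphic_2314))).
(* Only the count for 3124 is reindexed by [flip_blocks]; the two predicates then agree word by
   word. *)
rewrite -(seq.permP (perm_flip_permutations n)) count_map.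
apply: eq_in_count => t; rewrite mem_permutations => /perm_uniq ut /=.
have {}ut : uniq t by rewrite ut iota_uniq.
by rewrite avoids3_max_flip_blocks // seq_des_flip_blocks.
Qed.
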